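(* Let $Q$ be a finite quiver with two distinct arrows $y,z$ such that $s(y)=t(z)$ and $s(z)=t(y)$, and let $Q_1=\{y,z,x_3,\dots,x_k\}$. Let $\Phi$ be a potential of the form $\Phi=yz-F(y,z,x)$, where $F(y,z,x)$ is an analytic series in $y,z,x_3,\dots,x_k$ of order $\ge3$. Then there exists an analytic automorphism $H$ such that $$H(\Phi)=yz-v(x),$$ where $v(x)$ is an analytic series in $x_3,\dots,x_k$ of order $\ge3$; here the equality is understood up to cyclic permutation of words (i.e. as potentials).
   Context: $\widehat{\mathbb CQ}$ is the completed path algebra of $Q$; its elements are formal series $\sum_wa_ww$ over paths $w$ of length $|w|$. A series is analytic if there is $C>0$ with $|a_w|\le C^{|w|}$ for all $w$ with $|w|$ sufficiently large; the order of a series is the minimal length of a path with nonzero coefficient. Potentials are elements of $\widehat{\mathbb CQ}_{cyc}=\widehat{\mathbb CQ}/[\widehat{\mathbb CQ},\widehat{\mathbb CQ}]^{cl}$ (quotient by the adic closure of the commutator space), i.e. series of cyclic paths up to cyclic rotation. An analytic automorphism is a $\mathbb CQ_0$-algebra automorphism of $\widehat{\mathbb CQ}$ mapping analytic series to analytic series (its inverse is then also analytic). *)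

(* Defs.v *)
From HB Require Import structures.
From mathcomp Require Import all_boot all_order all_algebra.
From mathcomp Require Import boolp functions reals.
From mathcomp Require Import complex.
Set Implicit Arguments.
Unset Strict Implicit.
Unset Printing Implicit Defensive.
Import Order.TTheory GRing.Theory Num.Theory.
Local Open Scope ring_scope.
Local Open Scope complex_scope.
Local Open Scope quotient_scope.

Record quiver := Quiver {
  vertex : finType;
  arrow : finType;
  src : arrow -> vertex;
  tgt : arrow -> vertex }.

Section Paths.
Variable Q : quiver.
Implicit Types (i : vertex Q) (w : seq (arrow Q)).

(* Arrows compose like functions: the word [:: a1; ...; an] is a path when
   src a_k = tgt a_(k+1). A path is recorded with its final vertex tgt a1, so
   that (i, [::]) is the trivial path at i. *)
Fixpoint is_path i w : bool :=
  if w is a :: w' then (tgt a == i) && is_path (src a) w' else true.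

Fixpoint word_src i w : vertex Q :=
  if w is a :: w' then word_src (src a) w' else i.

Definition qpath := {p : vertex Q * seq (arrow Q) | is_path p.1 p.2}.

Definition word (p : qpath) : seq (arrow Q) := (val p).2.
Definition path_tgt (p : qpath) : vertex Q := (val p).1.
Definition plength (p : qpath) : nat := size (word p).

Lemma is_path_cat i w1 w2 :
  is_path i (w1 ++ w2) = is_path i w1 && is_path (word_src i w1) w2.
Proof. by elim: w1 i => //= a w1 IH i; rewrite IH andbA. Qed.

Lemma word_src_cat i w1 w2 :
  word_src i (w1 ++ w2) = word_src (word_src i w1) w2.
Proof. by elim: w1 i => //=. Qed.

Lemma arrow_pathP (a : arrow Q) : is_path (tgt a) [:: a].
Proof. by rewrite /= eqxx. Qed.

Definition arrow_path (a : arrow Q) : qpath := exist _ (tgt a, [:: a]) (arrow_pathP a).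

Lemma ptake_subproof k (p : qpath) : is_path (path_tgt p) (take k (word p)).
Proof.
by have := valP p; rewrite -{1}(cat_take_drop k (val p).2) is_path_cat => /andP[].
Qed.

Lemma pdrop_subproof k (p : qpath) :
  is_path (word_src (path_tgt p) (take k (word p))) (drop k (word p)).
Proof.
by have := valP p; rewrite -{1}(cat_take_drop k (val p).2) is_path_cat => /andP[].
Qed.

(* p is the concatenation of ptake k p and pdrop k p, and these are all the
   factorisations of p into two paths. *)
Definition ptake k (p : qpath) : qpath :=
  exist _ (path_tgt p, take k (word p)) (ptake_subproof k p).
Definition pdrop k (p : qpath) : qpath :=
  exist _ (word_src (path_tgt p) (take k (word p)), drop k (word p))
    (pdrop_subproof k p).

Lemma plength_ptake k p : (k <= plength p)%N -> plength (ptake k p) = k.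
Proof. exact: size_takel. Qed.

Lemma plength_pdrop k p : plength (pdrop k p) = (plength p - k)%N.
Proof. exact: size_drop. Qed.

Lemma ptake_ptake j k p : (j <= k)%N -> ptake j (ptake k p) = ptake j p.
Proof. by move=> jk; apply: val_inj; rewrite /= /word /= take_takel. Qed.

Lemma pdrop_pdrop j l p : pdrop l (pdrop j p) = pdrop (l + j) p.
Proof.
apply: val_inj; rewrite /= /word /path_tgt /= drop_drop.
by rewrite -word_src_cat addnC -takeD.
Qed.

Lemma pdrop_ptake j l p : pdrop j (ptake (l + j) p) = ptake l (pdrop j p).
Proof.
apply: val_inj; rewrite /= /word /path_tgt /= take_takel ?leq_addl //.
by rewrite take_drop.
Qed.

Lemma ptake_all p : ptake (plength p) p = p.
Proof. by apply: val_inj; case: p => -[i w] /= wP; rewrite /path_tgt /word take_size. Qed.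

Lemma pdrop0 p : pdrop 0 p = p.
Proof. by apply: val_inj; case: p => -[i w] /= wP; rewrite /path_tgt /word take0 drop0. Qed.

End Paths.

(* The completed path algebra: formal series of paths with complex
   coefficients. *)
Definition cpath_alg (R : realType) (Q : quiver) : Type := qpath Q -> R[i].

HB.instance Definition _ (R : realType) (Q : quiver) :=
  GRing.Zmodule.copy (cpath_alg R Q) (qpath Q -> R[i]).

Section CompletedPathAlgebra.
Variables (R : realType) (Q : quiver).
Local Notation A := (cpath_alg R Q).
Implicit Types (f g h : A) (p : qpath Q).

(* The embedding of CQ_0, the algebra of functions on the vertices. *)
Definition vertex_series (d : vertex Q -> R[i]) : A :=
  fun p => if word p is [::] then d (path_tgt p) else 0.

Definition path_series (q : qpath Q) : A := fun p => (p == q)%:R.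
Definition arrow_series (a : arrow Q) : A := path_series (arrow_path a).

Definition series_one : A := vertex_series (fun _ => 1).
Definition series_mul f g : A :=
  fun p => \sum_(0 <= k < (plength p).+1) f (ptake k p) * g (pdrop k p).

Lemma series_addE f g p : (f + g) p = f p + g p. Proof. by []. Qed.

Lemma series_subE f g p : (f - g) p = f p - g p. Proof. by []. Qed.

Lemma series_mulA : associative series_mul.
Proof.
move=> f g h; apply/funext => p; rewrite /series_mul; apply/esym.
set n := plength p.
transitivity (\sum_(0 <= k < n.+1) \sum_(0 <= j < n.+1 | (j <= k)%N)
   f (ptake j p) * g (pdrop j (ptake k p)) * h (pdrop k p)).
  apply: eq_big_nat => k /andP[_ kn]; rewrite plength_ptake // big_distrl /=.
  rewrite (big_nat_widen _ _ _ _ _ kn) /=.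
  apply: eq_bigr => j jk; rewrite ptake_ptake //.
rewrite (exchange_big_dep_nat predT) //=; apply: eq_big_nat => j /andP[_ jn].
rewrite big_distrr /= plength_pdrop -/n -(subSn jn).
rewrite -(big_nat_widenl j 0 n.+1 predT) //=.
rewrite -{1}[j]add0n big_addn; apply: eq_bigr => l _.
by rewrite pdrop_ptake pdrop_pdrop mulrA.
Qed.

Lemma series_mul1l : left_id series_one series_mul.
Proof.
move=> f; apply/funext => p; rewrite /series_mul big_nat_recl //= pdrop0.
rewrite /series_one /vertex_series {1}/ptake /word /= take0 mul1r.
rewrite big_nat big1 ?addr0 // => k /andP[_ kn].
rewrite -/(word p); case E : (word p) => [|a w] /=; last by rewrite mul0r.
by move: kn; rewrite /plength E.
Qed.

Lemma series_mul1r : right_id series_one series_mul.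
Proof.
move=> f; apply/funext => p; rewrite /series_mul big_nat_recr //= ptake_all.
rewrite /series_one /vertex_series {2}/pdrop /word /= drop_size mulr1.
rewrite big_nat big1 ?add0r // => k /andP[_ kn].
rewrite -/(word p); case E : (drop k (word p)) => [|a w] /=; last by rewrite mulr0.
by have := size_drop k (word p); rewrite E /= => /esym/eqP; rewrite subn_eq0 leqNgt kn.
Qed.

Lemma series_mulDl : left_distributive series_mul +%R.
Proof.
move=> f g h; apply/funext => p; rewrite series_addE /series_mul -big_split.
by apply: eq_bigr => k _; rewrite series_addE mulrDl.
Qed.

Lemma series_mulDr : right_distributive series_mul +%R.
Proof.
move=> f g h; apply/funext => p; rewrite series_addE /series_mul -big_split.
by apply: eq_bigr => k _; rewrite series_addE mulrDr.
Qed.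

HB.instance Definition _ :=
  GRing.Zmodule_isPzRing.Build A series_mulA series_mul1l series_mul1r series_mulDl series_mulDr.

Definition order_ge (n : nat) f : Prop := forall p, f p != 0 -> (n <= plength p)%N.

Definition analytic f : Prop :=
  exists2 C : R, 0 < C &
    exists N : nat, forall p, (N <= plength p)%N -> `|f p| <= (C ^+ plength p)%:C.

Definition series_avoiding (a b : arrow Q) f : Prop :=
  forall p, f p != 0 -> (a \notin word p) && (b \notin word p).

(* The commutator space [A, A]; it is closed under scalars because
   c [u, v] = [c u, v]. *)
Definition commutator_space f : Prop :=
  exists s : seq (A * A), f = \sum_(uv <- s) (uv.1 * uv.2 - uv.2 * uv.1).

(* Its closure in the adic topology, whose basic neighbourhoods of 0 are the
   sets of series of order at least n. *)
Definition commutator_closure : {pred A} := fun f =>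
  `[< forall n, exists2 c, commutator_space c & order_ge n (f - c) >].

Lemma commutator_closureP f :
  reflect (forall n, exists2 c, commutator_space c & order_ge n (f - c))
          (f \in commutator_closure).
Proof. exact: asboolP. Qed.

Lemma order_geB n f g : order_ge n f -> order_ge n g -> order_ge n (f - g).
Proof.
move=> hf hg p; apply: contraNT => np.
rewrite series_subE.
have -> : f p = 0 by apply/eqP; apply: contraNT np => /hf.
have -> : g p = 0 by apply/eqP; apply: contraNT np => /hg.
by rewrite subr0.
Qed.

Lemma commutator_spaceB f g :
  commutator_space f -> commutator_space g -> commutator_space (f - g).
Proof.
move=> [s ->] [t ->]; exists (s ++ [seq (uv.2, uv.1) | uv <- t]).
rewrite big_cat big_map /= -sumrN; congr (_ + _).
by apply: eq_bigr => uv _; rewrite opprB.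
Qed.

Lemma commutator_closure_zmod : zmod_closed commutator_closure.
Proof.
split=> [|f g /commutator_closureP hf /commutator_closureP hg];
  apply/commutator_closureP => n.
  by exists 0; [exists [::]; rewrite big_nil | rewrite subr0 => p; rewrite eqxx].
have [c hc fc] := hf n; have [d hd gd] := hg n.
exists (c - d); first exact: commutator_spaceB.
have -> : f - g - (c - d) = (f - c) - (g - d).
  by rewrite !opprB addrACA [in RHS]addrACA [- g + _]addrC.
exact: order_geB.
Qed.

HB.instance Definition _ :=
  GRing.isZmodClosed.Build A commutator_closure commutator_closure_zmod.

Definition potential : Type := Quotient.quot commutator_closure.
Definition potential_of f : potential := \pi f.

Lemma potential_ofP f g :
  potential_of f = potential_of g <-> f - g \in commutator_closure.
Proof.
by rewrite -Quotient.equivE; split=> [/eqP|h]; [|apply/eqP]; rewrite piE.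
Qed.

(* The ring automorphisms that restrict to the identity on CQ_0; they are
   automatically C-linear. *)
Definition algebra_automorphism (H : {rmorphism A -> A}) : Prop :=
  bijective H /\ forall d, H (vertex_series d) = vertex_series d.

Definition analytic_automorphism (H : {rmorphism A -> A}) : Prop :=
  algebra_automorphism H /\ forall f, analytic f -> analytic (H f).

End CompletedPathAlgebra.

(* Main.v *)
(** Replacing [y] by [y + eta] and [z] by [z + zeta] turns [y z - F] into
   [y z + y zeta + eta z - W] where [W = F(y + eta, z + zeta, x) - eta zeta].
   Rotating every word of [W] until its first letter is [y] or [z] gives
   [W = y A(W) + B(W) z + v] up to commutators, where [v] collects the words of
   [W] without [y] and [z].  It thus suffices to solve the fixed-point equation
   [zeta = A(W), eta = B(W)]: it is contracting in the adic topology because [F]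
   has order at least 3 and [eta], [zeta] have order at least 2.

   The weighted l1-norm [sum_p |f_p| r^|p|] is submultiplicative, and rotation
   does not increase it, so [A] and [B] have norm at most [1 / r].  For small [r]
   the bound [|eta| + |zeta| <= r / 4] is therefore preserved by the iteration,
   which makes the solution analytic.  The substitution is bijective because it
   is the identity up to terms of higher order. *)
Require Import Defs.
From HB Require Import structures.
From mathcomp Require Import all_boot all_order all_algebra.
From mathcomp Require Import boolp functions reals complex.
From mathcomp Require Import ring lra zify.
Set Implicit Arguments.
Unset Strict Implicit.
Unset Printing Implicit Defensive.
Import Order.TTheory GRing.Theory Num.Theory.
Local Open Scope ring_scope.

(** * Left derivatives of path series *)

Section PathCons.
Variable Q : quiver.
Implicit Types (i : vertex Q) (a : arrow Q) (p q : qpath Q).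

Definition trivial_path i : qpath Q := exist _ (i, [::]) isT.

Lemma path_cons_subproof a p :
  is_path (tgt a) (a :: if path_tgt p == src a then word p else [::]).
Proof. by rewrite /= eqxx; case: eqP => //= <-; exact: (valP p). Qed.

(* Junk value: if p does not end where a starts, the result is the path a. *)
Definition path_cons a p : qpath Q := exist _ (tgt a, _) (path_cons_subproof a p).

Lemma word_cons a p : path_tgt p = src a -> word (path_cons a p) = a :: word p.
Proof. by move=> e; rewrite /word /= e eqxx. Qed.

Lemma plength_cons a p : path_tgt p = src a -> plength (path_cons a p) = (plength p).+1.
Proof. by move=> e; rewrite /plength word_cons. Qed.

Lemma qpath_eq p q : path_tgt p = path_tgt q -> word p = word q -> p = q.
Proof.
case: p q => [[i w] wP] [[j v] vP]; rewrite /path_tgt /word /= => e f.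
by apply: val_inj => /=; rewrite e f.
Qed.

Lemma qpath_case p :
  (exists i, p = trivial_path i) \/
  (exists a p', path_tgt p' = src a /\ p = path_cons a p').
Proof.
case: p => [[i [|a w]] wP]; first by left; exists i; apply: qpath_eq.
right; have /= /andP[/eqP ai wP'] := wP.
exists a, (exist _ (src a, w) wP'); split=> //.
by apply: qpath_eq => //; rewrite word_cons.
Qed.

Lemma word_ptake k p : word (ptake k p) = take k (word p). Proof. by []. Qed.

Lemma word_pdrop k p : word (pdrop k p) = drop k (word p). Proof. by []. Qed.

Lemma path_tgt_pdrop k p :
  path_tgt (pdrop k p) = word_src (path_tgt p) (take k (word p)).
Proof. by []. Qed.

Lemma ptake0 p : ptake 0 p = trivial_path (path_tgt p).
Proof. by apply: qpath_eq => //; rewrite word_ptake take0. Qed.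

Lemma ptakeS a p k : path_tgt p = src a ->
  ptake k.+1 (path_cons a p) = path_cons a (ptake k p).
Proof.
by move=> e; apply: qpath_eq => //; rewrite word_cons // !word_ptake word_cons.
Qed.

Lemma pdropS a p k : path_tgt p = src a ->
  pdrop k.+1 (path_cons a p) = pdrop k p.
Proof.
move=> e; apply: qpath_eq; last by rewrite !word_pdrop word_cons.
by rewrite !path_tgt_pdrop word_cons //= e.
Qed.

Lemma plength0 p : plength p = 0%N -> p = trivial_path (path_tgt p).
Proof. by move=> /size0nil p0; apply: qpath_eq. Qed.

End PathCons.

Section LeftDerivatives.
Variables (R : realType) (Q : quiver).
Local Notation A := (cpath_alg R Q).
Implicit Types (f g h : A) (p : qpath Q) (a : arrow Q) (d : vertex Q -> R[i]).

Definition const_series (c : R[i]) : A := vertex_series (fun _ => c).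
Definition vcoef f (i : vertex Q) : R[i] := f (trivial_path i).
(** Strips a leading [a] from every word. The test discards the junk values of [path_cons], so the
    result is supported on paths ending at [src a]. *)
Definition lderiv a f : A :=
  fun p => if path_tgt p == src a then f (path_cons a p) else 0.

Lemma lderivE a f p : path_tgt p = src a -> lderiv a f p = f (path_cons a p).
Proof. by rewrite /lderiv => ->; rewrite eqxx. Qed.

Lemma lderiv_zmod a : zmod_morphism (lderiv a : A -> A).
Proof.
move=> f g; apply/funext => p; rewrite /lderiv !series_subE.
by case: ifP => _; rewrite ?series_subE ?subr0.
Qed.
HB.instance Definition _ a := GRing.isZmodMorphism.Build A A (lderiv a) (lderiv_zmod a).

Lemma series_oppE f p : (- f) p = - f p. Proof. by []. Qed.

Lemma series_sumE (I : Type) (r : seq I) (P : pred I) (F : I -> A) p :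
  (\sum_(i <- r | P i) F i) p = \sum_(i <- r | P i) F i p.
Proof. by elim/big_rec2: _ => // i x f _ <-. Qed.

Lemma series_ext f g : vcoef f =1 vcoef g ->
  (forall a, lderiv a f = lderiv a g) -> f = g.
Proof.
move=> e0 eS; apply/funext => p.
have [[i ->]|[a [p' [e ->]]]] := qpath_case p; first exact: e0.
by rewrite -!lderivE // eS.
Qed.

Lemma vcoefM f g i : vcoef (f * g) i = vcoef f i * vcoef g i.
Proof.
rewrite /vcoef /GRing.mul /= /series_mul /plength /= big_nat1 ptake0.
by rewrite pdrop0.
Qed.

Lemma vcoef_vertex d i : vcoef (vertex_series d) i = d i. Proof. by []. Qed.

Lemma lderiv_vertex a d : lderiv a (vertex_series d) = 0 :> A.
Proof.
by apply/funext=> p; rewrite /lderiv; case: eqP => // e; rewrite /vertex_series word_cons.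
Qed.

Lemma vertex_mulE d f p : (vertex_series d * f) p = d (path_tgt p) * f p.
Proof.
rewrite /GRing.mul /= /series_mul big_nat_recl // ptake0 pdrop0 big_nat big1 ?addr0 //.
move=> k /andP[_ kp]; have : plength (ptake k.+1 p) = k.+1 by exact: plength_ptake.
by rewrite /plength /vertex_series; case: (word _) => // *; rewrite mul0r.
Qed.

Lemma mul_vertexE d f p :
  (f * vertex_series d) p = f p * d (path_tgt (pdrop (plength p) p)).
Proof.
rewrite /GRing.mul /= /series_mul big_nat_recr //= ptake_all.
have -> : vertex_series d (pdrop (plength p) p) = d (path_tgt (pdrop (plength p) p)).
  by rewrite /vertex_series word_pdrop drop_size.
rewrite big_nat big1 ?add0r // => k /andP[_ kp].
have := plength_pdrop k p; rewrite /vertex_series {1}/plength.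
by case: (word (pdrop k p)) => [/= e|*]; [lia | rewrite mulr0].
Qed.

Lemma const_comm c f : const_series c * f = f * const_series c.
Proof. by apply/funext => p; rewrite mul_vertexE vertex_mulE mulrC. Qed.

Lemma vertex_seriesM d1 d2 :
  vertex_series d1 * vertex_series d2 = vertex_series (fun i => d1 i * d2 i) :> A.
Proof.
apply/funext => p; rewrite vertex_mulE /vertex_series; case: (word p) => //= *.
by rewrite mulr0.
Qed.

(** A factorisation of the path [a p] either has the trivial path at [tgt a] as its first factor, or
    comes from a factorisation of [p] by putting [a] in front. *)
Lemma lderivM a f g :
  lderiv a (f * g) = lderiv a f * g + const_series (vcoef f (tgt a)) * lderiv a g.
Proof.
apply/funext => p; rewrite series_addE vertex_mulE.
case: (eqVneq (path_tgt p) (src a)) => [e|ne]; last first.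
  rewrite {1 3}/lderiv (negPf ne) mulr0 addr0 /GRing.mul /= /series_mul.
  by rewrite big1 // => k _; rewrite /lderiv (negPf (ne : path_tgt (ptake k p) != _)) mul0r.
rewrite !lderivE // {1}/GRing.mul /= /series_mul plength_cons // big_nat_recl //.
rewrite ptake0 pdrop0 addrC; congr (_ + _).
rewrite [in RHS]/GRing.mul /= /series_mul; apply: eq_bigr => k _.
by rewrite ptakeS // pdropS // lderivE.
Qed.

Lemma vcoef_arrow a i : vcoef (arrow_series R a) i = 0.
Proof. by rewrite /vcoef /arrow_series /path_series; case: eqP. Qed.

Definition vertex_idem (i : vertex Q) : A := vertex_series (fun j => (j == i)%:R).

Lemma lderiv_arrow a b :
  lderiv a (arrow_series R b) = if a == b then vertex_idem (src a) else 0.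
Proof.
apply/funext => p; rewrite /lderiv /arrow_series /path_series.
have [e|ne] := eqVneq (path_tgt p) (src a); last first.
  case: eqP => // _; rewrite /vertex_idem /vertex_series (negPf ne).
  by case: (word p).
have [<-|nab] := eqVneq a b; last first.
  case: eqP => // ab; have := congr1 (@word Q) ab; rewrite word_cons // => -[/eqP].
  by rewrite (negPf nab).
rewrite /vertex_idem /vertex_series e eqxx; case: eqP => [|ab].
  by move=> /(congr1 (@word Q)); rewrite word_cons // => -[->].
case E : (word p) => [|//]; case: ab; apply: qpath_eq => //.
by rewrite word_cons // E.
Qed.

Lemma idem_lderiv a f : vertex_idem (src a) * lderiv a f = lderiv a f.
Proof.
apply/funext => p; rewrite vertex_mulE /lderiv.
by case: eqP; rewrite ?mul1r ?mulr0.
Qed.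

Lemma lderiv_arrowM a b f :
  lderiv a (arrow_series R b * f) = if a == b then vertex_idem (src a) * f else 0.
Proof.
rewrite lderivM vcoef_arrow lderiv_arrow.
have -> : const_series 0 = 0 :> A.
  by apply/funext => p; rewrite /const_series /vertex_series; case: (word p).
by rewrite mul0r addr0; case: eqP => // _; rewrite mul0r.
Qed.

(** Sorts the words by their first letter. Rotation, substitution and the weighted norm all follow
    this expansion. *)
Lemma lderiv_expansion f :
  f = vertex_series (vcoef f) + \sum_a arrow_series R a * lderiv a f.
Proof.
apply: series_ext => [i|a].
  rewrite {2}/vcoef series_addE series_sumE big1 ?addr0 // => a _.
  by rewrite -/(vcoef _ i) vcoefM vcoef_arrow mul0r.
rewrite raddfD /= lderiv_vertex add0r raddf_sum /= (bigD1 a) //=.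
rewrite lderiv_arrowM eqxx idem_lderiv big1 ?addr0 // => b ne.
by rewrite lderiv_arrowM eq_sym (negPf ne).
Qed.

(** * Orders and adic limits *)

Lemma order_geP n f : order_ge n f <-> forall p, (plength p < n)%N -> f p = 0.
Proof.
split=> h p; first by move=> pn; apply/eqP; apply: contraTT pn => /h; rewrite -leqNgt.
by apply: contraNT; rewrite -ltnNge => /h ->.
Qed.

Lemma order_ge0 f : order_ge 0 f. Proof. by []. Qed.

Lemma order_ge_zero n : order_ge n (0 : A).
Proof. by apply/order_geP. Qed.

Lemma order_ge_le m n f : (m <= n)%N -> order_ge n f -> order_ge m f.
Proof. by move=> mn h p /h; apply: leq_trans. Qed.

Lemma order_geD n f g : order_ge n f -> order_ge n g -> order_ge n (f + g).
Proof.
move=> /order_geP hf /order_geP hg; apply/order_geP => p pn.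
by rewrite series_addE hf // hg // addr0.
Qed.

Lemma order_geN n f : order_ge n f -> order_ge n (- f).
Proof. by rewrite -sub0r; apply: order_geB; exact: order_ge_zero. Qed.

Lemma order_ge_sum n (I : Type) (r : seq I) (P : pred I) (F : I -> A) :
  (forall i, P i -> order_ge n (F i)) -> order_ge n (\sum_(i <- r | P i) F i).
Proof.
move=> h; elim/big_rec: _ => [|i x Pi IH]; first exact: order_ge_zero.
by apply: order_geD => //; exact: h.
Qed.

Lemma order_ge_eq f g : (forall n, order_ge n (f - g)) -> f = g.
Proof.
move=> h; apply/funext => p; apply/eqP; rewrite -subr_eq0 -series_subE.
by apply/eqP; have /order_geP := h (plength p).+1; apply.
Qed.

Lemma order_ge_trans n f g h :
  order_ge n (f - g) -> order_ge n (g - h) -> order_ge n (f - h).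
Proof. by move=> h1 h2; rewrite -(subrKA g); exact: order_geD. Qed.

Lemma order_ge_subC n f g : order_ge n (f - g) -> order_ge n (g - f).
Proof. by move=> h; rewrite -opprB; exact: order_geN. Qed.

Lemma order_geM m n f g : order_ge m f -> order_ge n g -> order_ge (m + n) (f * g).
Proof.
move=> /order_geP hf /order_geP hg; apply/order_geP => p pn.
rewrite /GRing.mul /= /series_mul big_nat big1 // => k /andP[_ kp].
have [km|mk] := ltnP k m; first by rewrite hf ?mul0r // plength_ptake.
by rewrite hg ?mulr0 // plength_pdrop; lia.
Qed.

Lemma order_ge_lderiv n a f : order_ge n.+1 f -> order_ge n (lderiv a f).
Proof.
move=> /order_geP hf; apply/order_geP => p pn; rewrite /lderiv.
by case: eqP => // e; rewrite hf // plength_cons.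
Qed.

Lemma order_ge_lderiv_pred n a f : order_ge n f -> order_ge n.-1 (lderiv a f).
Proof. by case: n => [|n]; [move=> _; exact: order_ge0 | exact: order_ge_lderiv]. Qed.

Lemma order_ge_arrow a : order_ge 1 (arrow_series R a).
Proof.
by apply/order_geP => p; rewrite ltnS leqn0 => /eqP /plength0 ->; exact: vcoef_arrow.
Qed.

Lemma order_ge1_vcoef f i : order_ge 1 f -> vcoef f i = 0.
Proof. by move=> /order_geP; apply. Qed.

(** At the convergence rate of [adic_limP], a coefficient at length [n] is certain to be constant
    from term [n.+1] on. *)
Definition adic_lim (s : nat -> A) : A := fun p => s (plength p).+1 p.

Lemma adic_limP (s : nat -> A) : (forall n, order_ge n (s n.+1 - s n)) ->
  forall n, order_ge n (adic_lim s - s n).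
Proof.
move=> hs; have ch m n : (m <= n)%N -> order_ge m (s n - s m).
  elim: n => [|n IH]; first by rewrite leqn0 => /eqP ->.
  rewrite leq_eqVlt => /predU1P[->|mn]; first by rewrite subrr; exact: order_ge_zero.
  by apply: (order_ge_trans (g := s n)); [exact: order_ge_le (hs n) | exact: IH].
move=> n; apply/order_geP => p pn; rewrite series_subE /adic_lim -opprB -series_subE.
by rewrite series_subE -series_subE; have /order_geP -> := ch _ _ pn; rewrite ?oppr0.
Qed.

End LeftDerivatives.

(** * Rotation modulo commutators *)

Section Rotation.
Variables (R : realType) (Q : quiver) (S : pred (arrow Q)).
Local Notation A := (cpath_alg R Q).
Implicit Types (f g W : A) (p : qpath Q) (a : arrow Q).

Lemma commutator_space0 : commutator_space (0 : A).
Proof. by exists [::]; rewrite big_nil. Qed.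

Lemma commutator_spaceD f g :
  commutator_space f -> commutator_space g -> commutator_space (f + g).
Proof.
move=> hf hg; rewrite -[g]opprK; apply: commutator_spaceB => //.
by rewrite -sub0r; apply: commutator_spaceB => //; exact: commutator_space0.
Qed.

Lemma commutator_space_sum (I : Type) (r : seq I) (P : pred I) (F : I -> A) :
  (forall i, P i -> commutator_space (F i)) ->
  commutator_space (\sum_(i <- r | P i) F i).
Proof.
move=> h; elim/big_rec: _ => [|i x Pi IH]; first exact: commutator_space0.
by apply: commutator_spaceD => //; exact: h.
Qed.

Lemma commutator_space_comm f g : commutator_space (f * g - g * f).
Proof. by exists [:: (f, g)]; rewrite big_seq1. Qed.

Lemma commutator_space_closure f : commutator_space f -> f \in @commutator_closure R Q.
Proof.
move=> hf; apply/commutator_closureP => n.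
by exists f => //; rewrite subrr; exact: order_ge_zero.
Qed.

(** Moves the first letter of a word to its end. Words starting in [S] and trivial paths drop out,
    and so do words that are not cyclic, since the product then vanishes. *)
Definition rotate W : A := \sum_(a | ~~ S a) lderiv a W * arrow_series R a.

Lemma rotate_zmod : zmod_morphism (rotate : A -> A).
Proof.
move=> f g; rewrite /rotate -sumrB; apply: eq_bigr => a _.
by rewrite raddfB mulrBl.
Qed.
HB.instance Definition _ := GRing.isZmodMorphism.Build A A rotate rotate_zmod.

Lemma order_ge_rotate n W : order_ge n W -> order_ge n (rotate W).
Proof.
move=> hW; apply: order_ge_sum => a _; apply: (@order_ge_le _ _ _ (n.-1 + 1)); first lia.
by apply: order_geM; [exact: order_ge_lderiv_pred | exact: order_ge_arrow].
Qed.

Lemma order_ge_iter_rotate n m W : order_ge n W -> order_ge n (iter m rotate W).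
Proof. by move=> hW; elim: m => //= m; exact: order_ge_rotate. Qed.

Lemma iter_rotateB m f g :
  iter m rotate (f - g) = iter m rotate f - iter m rotate g.
Proof. by elim: m => //= m ->; rewrite raddfB. Qed.

Lemma vertex_series0 f : order_ge 1 f -> vertex_series (vcoef f) = 0.
Proof.
move=> f1; apply/funext => p; rewrite /vertex_series; case: (word p) => //.
by rewrite order_ge1_vcoef.
Qed.

(** In the first-letter expansion, the two factors are swapped whenever the letter lies outside [S],
    at the cost of a commutator. Order at least 1 excludes trivial paths. *)
Lemma rotate_comm W : order_ge 1 W ->
  commutator_space (W - (\sum_(a | S a) arrow_series R a * lderiv a W + rotate W)).
Proof.
move=> W1; rewrite {1}[W]lderiv_expansion vertex_series0 // add0r (bigID S) /=.
rewrite opprD addrACA subrr add0r -sumrB.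
by apply: commutator_space_sum => a _; exact: commutator_space_comm.
Qed.

(** Words with a letter of [S] in front after [j < m] rotations are set aside; only the others are
    rotated again. *)
Lemma rotate_iter_comm m W : order_ge 1 W ->
  commutator_space (W - (\sum_(a | S a) arrow_series R a *
     (\sum_(j < m) lderiv a (iter j rotate W)) + iter m rotate W)).
Proof.
move=> W1; elim: m => [|m IH].
  rewrite big1 ?add0r /= ?subrr; first exact: commutator_space0.
  by move=> a _; rewrite big_ord0 mulr0.
have /= h := rotate_comm (order_ge_iter_rotate (m := m) W1).
have := commutator_spaceD IH h; congr commutator_space; rewrite /=.
under [in RHS]eq_bigr => a _ do rewrite big_ord_recr /= mulrDr.
rewrite big_split /= !opprD !addrA; set X := \sum_(_ | _) _; set Y := \sum_(_ | _) _.
by rewrite -[X in X - Y]addrA addNr addr0.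
Qed.

Lemma sum_neq0 (V : zmodType) (I : Type) (r : seq I) (P : pred I) (F : I -> V) :
  \sum_(i <- r | P i) F i != 0 -> exists2 i, P i & F i != 0.
Proof.
move=> s0; apply: contrapT => k; move/eqP: s0; apply; apply: big1 => i Pi.
by apply: contrapT => /eqP Fi; apply: k; exists i.
Qed.

Lemma mul_arrow_word f a p : (f * arrow_series R a) p != 0 ->
  exists2 q, f q != 0 & word p = rcons (word q) a.
Proof.
rewrite /GRing.mul /= /series_mul => /sum_neq0[k _].
rewrite mulf_eq0 negb_or => /andP[fk ak]; exists (ptake k p) => //.
have /(congr1 (@word Q)) : pdrop k p = arrow_path a.
  move: ak; rewrite /arrow_series /path_series.
  by case: (pdrop k p =P arrow_path a) => // _; rewrite eqxx.
rewrite word_pdrop word_ptake -cats1 -[[:: a]]/(word (arrow_path a)) => <-.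
by rewrite cat_take_drop.
Qed.

Lemma rotate_word W p : rotate W p != 0 -> exists a q,
  [/\ ~~ S a, word p = rcons (word q) a & exists2 q', W q' != 0 & word q' = a :: word q].
Proof.
rewrite /rotate series_sumE => /sum_neq0[a Sa ha].
have [q hq ->] := mul_arrow_word ha; exists a, q; split=> //.
move: hq; rewrite /lderiv; case: (eqVneq (path_tgt q) (src a)) => [e hq|]; last by rewrite eqxx.
by exists (path_cons a q) => //; rewrite word_cons.
Qed.

(** Cyclic words without letters of [S] would rotate for ever, so they are removed before rotation
    is iterated. *)
Definition hit_part W : A := fun p => if has S (word p) then W p else 0.

Lemma hit_part_zmod : zmod_morphism (hit_part : A -> A).
Proof.
move=> f g; apply/funext => p; rewrite series_subE /hit_part.
by case: ifP => _; rewrite ?subr0.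
Qed.
HB.instance Definition _ := GRing.isZmodMorphism.Build A A hit_part hit_part_zmod.

Lemma order_ge_hit_part n W : order_ge n W -> order_ge n (hit_part W).
Proof.
by move=> /order_geP hW; apply/order_geP => p pn; rewrite /hit_part hW // if_same.
Qed.

(* A word hit by S at position i is used up after i rotations. *)
Lemma iter_rotate_hit m W p : iter m rotate (hit_part W) p != 0 ->
  (find S (word p) + m < plength p)%N.
Proof.
elim: m p => [|m IH] p /=.
  rewrite /hit_part addn0 /plength -has_find; case: ifP => //; by rewrite eqxx.
case/rotate_word => a [q [Sa wp [q' /IH + e]]].
rewrite /plength wp e /= (negPf Sa) size_rcons -cats1 find_cat => h.
(* If [q] missed [S], the first hit in [q'] would be placed at its length, against [h]. *)
by case: ifP => hq; [lia | rewrite hasNfind ?hq // in h; lia].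
Qed.

(** The first hit lies inside the word, so a word that survives [m] rotations is longer than [m].
    This makes the sum over rotations converge. *)
Lemma order_iter_rotate_hit m W : order_ge m.+1 (iter m rotate (hit_part W)).
Proof. by move=> p /iter_rotate_hit; lia. Qed.

(** Sums what follows a leading [a] over all numbers of rotations. With [S] made of [y] and [z],
    these letters yield A(W) and B(W) of the overview, up to cutting by idempotents. *)
Definition collect a W : A :=
  adic_lim (fun m => \sum_(j < m) lderiv a (iter j rotate (hit_part W))).

Lemma collectP a W n :
  order_ge n (collect a W - \sum_(j < n) lderiv a (iter j rotate (hit_part W))).
Proof.
apply: (adic_limP (s := fun m => \sum_(j < m) lderiv a (iter j rotate (hit_part W)))) => m.
rewrite big_ord_recr /= addrAC subrr add0r; apply: order_ge_lderiv.
exact: order_iter_rotate_hit.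
Qed.

Lemma collect_zmod a : zmod_morphism (collect a : A -> A).
Proof.
move=> f g; apply/funext => p; rewrite series_subE /collect /adic_lim -series_subE.
rewrite -sumrB raddfB; congr (_ p); apply: eq_bigr => j _.
by rewrite iter_rotateB raddfB.
Qed.
HB.instance Definition _ a := GRing.isZmodMorphism.Build A A (collect a) (collect_zmod a).

Lemma order_ge_collect n a W : order_ge n.+1 W -> order_ge n (collect a W).
Proof.
move=> hW; rewrite -[collect a W](subrK (\sum_(j < n) lderiv a (iter j rotate (hit_part W)))).
apply: order_geD; first exact: collectP.
apply: order_ge_sum => j _; apply: order_ge_lderiv; apply: order_ge_iter_rotate.
exact: order_ge_hit_part.
Qed.

(** Stopping after [n] rotations leaves a finite sum of commutators, by [rotate_iter_comm]. The
    remaining iterate and the tails of the collected series have order at least [n], so the closure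
    absorbs them. *)
Lemma collect_comm W : order_ge 1 W ->
  W - (\sum_(a | S a) arrow_series R a * collect a W + (W - hit_part W))
    \in @commutator_closure R Q.
Proof.
move=> W1; apply/commutator_closureP => n.
have := rotate_iter_comm n (order_ge_hit_part W1).
set X := \sum_(_ | _) _; set Y := iter _ _ _ => h; exists (hit_part W - (X + Y)) => //.
set Z := \sum_(_ | _) _.
have -> : W - (Z + (W - hit_part W)) - (hit_part W - (X + Y)) = Y - (Z - X).
  apply/eqP; rewrite -subr_eq0; apply/eqP.
  move: (hit_part W) => U; move: X Y Z h => X Y Z _.
  apply/funext => p; rewrite !(series_subE, series_addE, series_oppE) /GRing.zero /=; ring.
apply: order_geB.
  by apply: (order_ge_le (leqnSn n)); exact: order_iter_rotate_hit.
rewrite /Z /X -sumrB; apply: order_ge_sum => a _; rewrite -mulrBr.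
apply: (order_ge_le (leqnSn n)); rewrite -add1n.
by apply: order_geM; [exact: order_ge_arrow | exact: collectP].
Qed.

Lemma idem_collect a W : vertex_idem R (src a) * collect a W = collect a W.
Proof.
apply/funext => p; rewrite vertex_mulE /collect /adic_lim series_sumE big_distrr /=.
by apply: eq_bigr => j _; rewrite -[in RHS]idem_lderiv vertex_mulE.
Qed.

End Rotation.

(** * Substitution of series for arrows *)

Section Substitution.
Variables (R : realType) (Q : quiver).
Local Notation A := (cpath_alg R Q).
Implicit Types (f g W : A) (p : qpath Q) (a : arrow Q) (h : arrow Q -> A).

(** Fuel [n] keeps the words of [f] of length below [n]; the others contribute only order at least
    [n] once every [h a] has order at least 1. *)
Fixpoint subst_rec h n f : A :=
  if n is m.+1
  then vertex_series (vcoef f) + \sum_a h a * subst_rec h m (lderiv a f) else 0.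

Definition subst h f : A := adic_lim (fun n => subst_rec h n f).

(** The order makes the expansion converge. The idempotent fixes where the paths of [h a] end; their
    starts are cut by the support of [lderiv a f], as [subst_arrow] shows. *)
Definition admissible h :=
  forall a, order_ge 1 (h a) /\ vertex_idem R (tgt a) * h a = h a.

Lemma vertex_series_sub f g :
  vertex_series (vcoef (f - g)) = vertex_series (vcoef f) - vertex_series (vcoef g) :> A.
Proof.
apply/funext => p; rewrite series_subE /vertex_series /vcoef.
by case: (word p) => [|_ _]; rewrite ?subr0.
Qed.

Lemma subst_recB h n f g : subst_rec h n (f - g) = subst_rec h n f - subst_rec h n g.
Proof.
elim: n f g => [|n IH] f g /=; first by rewrite subr0.
rewrite vertex_series_sub opprD addrACA; congr (_ + _); rewrite -sumrB.
by apply: eq_bigr => a _; rewrite raddfB IH mulrBr.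
Qed.

Lemma substB h f g : subst h (f - g) = subst h f - subst h g.
Proof.
by apply/funext => p; rewrite series_subE /subst /adic_lim -series_subE subst_recB.
Qed.

Lemma subst0 h : subst h 0 = 0.
Proof. by rewrite -(subrr (0 : A)) substB !subrr. Qed.

Section Admissible.
Variable h : arrow Q -> A.
Hypothesis ha : admissible h.

Let h1 a : order_ge 1 (h a). Proof. by have [] := ha a. Qed.

Lemma subst_recP n f : order_ge n (subst h f - subst_rec h n f).
Proof.
apply: (adic_limP (s := fun n => subst_rec h n f)) => m.
elim: m f => [|m IH] f; first exact: order_ge0.
rewrite /= opprD addrACA subrr add0r -sumrB; apply: order_ge_sum => a _.
by rewrite -mulrBr -add1n; apply: order_geM => //; exact: IH.
Qed.

Lemma substE f :
  subst h f = vertex_series (vcoef f) + \sum_a h a * subst h (lderiv a f).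
Proof.
apply: order_ge_eq => n; apply: (order_ge_trans (g := subst_rec h n.+1 f)).
  by apply: (order_ge_le (leqnSn n)); exact: subst_recP.
rewrite /= opprD addrACA subrr add0r -sumrB; apply: order_ge_sum => a _.
rewrite -mulrBr; apply: (order_ge_le (leqnSn n)); rewrite -add1n.
by apply: order_geM => //; apply: order_ge_subC; exact: subst_recP.
Qed.

Lemma order_ge_subst n f : order_ge n f -> order_ge n (subst h f).
Proof.
elim: n f => [|n IH] f hf; first exact: order_ge0.
rewrite substE vertex_series0 ?add0r; last exact: order_ge_le hf.
apply: order_ge_sum => a _; rewrite -add1n; apply: order_geM => //.
by apply: IH; exact: order_ge_lderiv.
Qed.

Lemma subst_vertex d : subst h (vertex_series d) = vertex_series d.
Proof.
rewrite substE big1 ?addr0 // => a _; rewrite lderiv_vertex.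
by rewrite subst0 mulr0.
Qed.

Lemma vertex_mul_admissible d a :
  vertex_series d * h a = h a * const_series (d (tgt a)).
Proof.
rewrite -(ha a).2 mulrA vertex_seriesM -const_comm mulrA vertex_seriesM.
congr (vertex_series _ * _); apply/funext => i.
by case: eqP => [->|]; rewrite ?mulr0.
Qed.

(** Induction on the order of the difference: one unfolding by [substE] cancels the vertex terms,
    and the factor [h a] gains one order. [substM] and [subst_id] follow the same pattern. *)
Lemma subst_vertexM d f : subst h (vertex_series d * f) = vertex_series d * subst h f.
Proof.
apply: order_ge_eq => n; elim: n d f => [|n IH] d f; first exact: order_ge0.
rewrite [in X in X - _]substE [in X in _ - X]substE mulrDr vertex_seriesM.
have -> : vertex_series (vcoef (vertex_series d * f)) =
          vertex_series (fun i => d i * vcoef f i) :> A.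
  by congr vertex_series; apply/funext => i; rewrite vcoefM.
rewrite opprD addrACA subrr add0r mulr_sumr -sumrB; apply: order_ge_sum => a _.
rewrite lderivM lderiv_vertex mul0r add0r mulrA vertex_mul_admissible -mulrA -mulrBr -add1n.
by apply: order_geM => //; exact: IH.
Qed.

Lemma substD f g : subst h (f + g) = subst h f + subst h g.
Proof.
by rewrite -[g in LHS]opprK -[- g]sub0r !substB subst0 sub0r opprK.
Qed.

Lemma substM f g : subst h (f * g) = subst h f * subst h g.
Proof.
apply: order_ge_eq => n; elim: n f g => [|n IH] f g; first exact: order_ge0.
(* The vertex part of [f] times [subst h g] is pulled back into a substitution and expanded in turn,
   so that the vertex terms on both sides match. *)
rewrite [in X in X - _]substE [subst h f]substE mulrDl -subst_vertexM.
rewrite [subst h (vertex_series _ * _)]substE.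
have -> : vertex_series (vcoef (vertex_series (vcoef f) * g)) = vertex_series (vcoef (f * g)) :> A.
  by congr vertex_series; apply/funext => i; rewrite !vcoefM.
rewrite -[X in _ - X]addrA opprD addrACA subrr add0r mulr_suml -big_split /= -sumrB.
apply: order_ge_sum => a _; rewrite !lderivM lderiv_vertex mul0r add0r substD mulrDr.
rewrite vcoef_vertex [X in _ - X]addrC opprD addrACA subrr addr0.
rewrite -mulrA -mulrBr -add1n.
by apply: order_geM => //; exact: IH.
Qed.

Lemma subst_arrow a : subst h (arrow_series R a) = h a * vertex_idem R (src a).
Proof.
rewrite substE vertex_series0 ?add0r; last exact: order_ge_arrow.
rewrite (bigD1 a) //= big1 ?addr0 ?lderiv_arrow ?eqxx ?subst_vertex // => b /negPf ba.
by rewrite lderiv_arrow ba subst0 mulr0.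
Qed.

End Admissible.

(** Exchanging [h] for [h'] one letter at a time: the exchanged letter contributes order [n], and
    each of the other letters, at least [k.-1] in number, contributes order at least 1. *)
Lemma subst_lipschitz h h' n k f : admissible h -> admissible h' -> (0 < n)%N ->
  (forall a, order_ge n (h a - h' a)) -> order_ge k f ->
  order_ge (n + k.-1) (subst h f - subst h' f).
Proof.
move=> ha ha' n0 hh hf.
(* The cap [m] on the order carries the induction, since the words of [f] have unbounded length. *)
suff H m : order_ge (minn m (n + k.-1)) (subst h f - subst h' f).
  by have := H (n + k.-1)%N; rewrite minnn.
elim: m k f hf => [|m IH] k f hf; first by rewrite min0n; exact: order_ge0.
rewrite (substE ha) (substE ha') opprD addrACA subrr add0r -sumrB.
apply: order_ge_sum => a _; have da := order_ge_lderiv_pred (a := a) hf.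
rewrite -(subrKA (h' a * subst h (lderiv a f))) -mulrBl -mulrBr; apply: order_geD.
  apply: (@order_ge_le _ _ _ (n + k.-1)); first exact: geq_minr.
  by apply: order_geM => //; exact: order_ge_subst.
apply: (@order_ge_le _ _ _ (1 + minn m (n + k.-1.-1))); first by lia.
by apply: order_geM; [exact: (ha' a).1 | exact: IH].
Qed.

Lemma arrow_admissible : admissible (@arrow_series R Q).
Proof.
move=> a; split; first exact: order_ge_arrow.
apply/funext => p; rewrite vertex_mulE /arrow_series /path_series.
by case: (eqVneq p _) => [->|]; rewrite ?mulr0 // /path_tgt /= eqxx mulr1.
Qed.

Lemma subst_id f : subst (@arrow_series R Q) f = f.
Proof.
apply: order_ge_eq => n; elim: n f => [|n IH] f; first exact: order_ge0.
rewrite (substE arrow_admissible) [in X in _ - X](lderiv_expansion f).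
rewrite opprD addrACA subrr add0r -sumrB; apply: order_ge_sum => a _.
rewrite -mulrBr -add1n; apply: order_geM => //; exact: order_ge_arrow.
Qed.

Lemma subst_rmorphism h : admissible h ->
  exists H : {rmorphism A -> A}, forall f, H f = subst h f.
Proof.
move=> ha.
have zm : zmod_morphism (subst h) by move=> f g; exact: substB.
have mm : monoid_morphism (subst h).
  by split=> [|f g]; [exact: subst_vertex | exact: substM].
pose H := HB.pack_for {rmorphism A -> A} (subst h)
  (GRing.isZmodMorphism.Build A A (subst h) zm)
  (GRing.isMonoidMorphism.Build A A (subst h) mm).
by exists H.
Qed.

(** * Invertibility of substitutions that are the identity to first order *)

Section Bijectivity.
Variable h : arrow Q -> A.
Hypotheses (ha : admissible h) (h2 : forall a, order_ge 2 (h a - arrow_series R a)).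

Let defect f : A := f - subst h f.

(** Apply [subst_lipschitz] to [h] and the identity substitution, whose values on arrows agree up to
    order 2. *)
Lemma order_ge_subst_defect k f : order_ge k f -> order_ge k.+1 (f - subst h f).
Proof.
move=> hf; apply: order_ge_subC; rewrite -{2}(subst_id f).
apply: (@order_ge_le _ _ _ (2 + k.-1)); first lia.
by apply: subst_lipschitz => //; exact: arrow_admissible.
Qed.

Let order_iter_defect n f : order_ge n (iter n defect f).
Proof.
by elim: n => [|n IH]; [exact: order_ge0 | rewrite iterS; exact: order_ge_subst_defect].
Qed.

(** The operator [defect] raises the order, so its Neumann series converges adically and gives a
    right inverse of [subst h]. *)
Lemma subst_bijective : bijective (subst h).
Proof.
pose s g n : A := \sum_(k < n) iter k defect g; pose inv g := adic_lim (s g).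
have invP g n : order_ge n (inv g - s g n).
  apply: (adic_limP (s := s g)) => m.
  by rewrite /s big_ord_recr /= addrAC subrr add0r; exact: order_iter_defect.
have substS g n : subst h (s g n) = g - iter n defect g.
  elim: n => [|n IH]; first by rewrite /s big_ord0 subrr subst0.
  rewrite /s big_ord_recr substD -/(s g n) IH /= -addrA; congr (_ + _).
  by rewrite /defect opprB addrC.
have invK : cancel inv (subst h).
  move=> g; apply: order_ge_eq => n.
  apply: (order_ge_trans (g := subst h (s g n))).
    by rewrite -substB; apply: order_ge_subst => //; exact: invP.
  by rewrite substS addrAC subrr sub0r; apply: order_geN; exact: order_iter_defect.
(* Injectivity makes the inverse two-sided: here [f - g] equals its own defect, so its order exceeds
   every bound. *)
exists inv => //; apply: inj_can_sym invK _ => f g fg.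
apply: order_ge_eq => n; elim: n => [|n IH]; first exact: order_ge0.
by have := order_ge_subst_defect IH; rewrite substB fg subrr subr0.
Qed.

End Bijectivity.

End Substitution.

(** * The weighted norm *)

Section WeightedNorm.
Variables (R : realType) (Q : quiver).
Local Notation A := (cpath_alg R Q).
Local Notation normc := Normc.normc.
Implicit Types (f g W : A) (p : qpath Q) (a : arrow Q) (h : arrow Q -> A) (r s t : R).

Lemma normc_norm (x : R[i]) : `|x| = (normc x)%:C%C.
Proof. by case: x. Qed.

Lemma normc_ge0 (x : R[i]) : 0 <= normc x.
Proof. by rewrite -lecR -normc_norm normr_ge0. Qed.

(* [weighted_norm r m f] is the sum of [|f p| * r ^ |p|] over the paths [p] of
   length less than [m]. *)
Fixpoint weighted_norm r m f : R :=
  if m is n.+1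
  then \sum_i normc (vcoef f i) + r * \sum_a weighted_norm r n (lderiv a f) else 0.

Lemma weighted_normS r m f : weighted_norm r m.+1 f =
  \sum_i normc (vcoef f i) + r * \sum_a weighted_norm r m (lderiv a f).
Proof. by []. Qed.

Lemma weighted_norm_ge0 r m f : 0 <= r -> 0 <= weighted_norm r m f.
Proof.
move=> r0; elim: m f => //= m IH f.
by rewrite addr_ge0 ?mulr_ge0 ?sumr_ge0 // => *; rewrite ?normc_ge0.
Qed.

Lemma weighted_norm_le r m f g : 0 <= r ->
  (forall p, normc (f p) <= normc (g p)) -> weighted_norm r m f <= weighted_norm r m g.
Proof.
move=> r0; elim: m f g => //= m IH f g fg.
rewrite lerD ?ler_wpM2l ?ler_sum // => [i _|a _]; first exact: fg.
by apply: IH => p; rewrite /lderiv; case: ifP.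
Qed.

Lemma weighted_norm_leS r m f : 0 <= r -> weighted_norm r m f <= weighted_norm r m.+1 f.
Proof.
move=> r0; elim: m f => [|m IH] f; first exact: weighted_norm_ge0.
by rewrite weighted_normS (weighted_normS r m.+1) lerD2l ler_wpM2l // ler_sum.
Qed.

Lemma weighted_normD r m f g : 0 <= r ->
  weighted_norm r m (f + g) <= weighted_norm r m f + weighted_norm r m g.
Proof.
move=> r0; elim: m f g => [|m IH] f g /=; first by rewrite addr0.
rewrite addrACA -mulrDr -!big_split /= lerD ?ler_wpM2l ?ler_sum // => [i _|a _].
  exact: le_normcD.
by rewrite raddfD.
Qed.

Lemma weighted_normN r m f : weighted_norm r m (- f) = weighted_norm r m f.
Proof.
elim: m f => //= m IH f; congr (_ + _ * _); apply: eq_bigr => i _; first exact: normcN.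
by rewrite raddfN.
Qed.

Lemma weighted_norm0 r m : weighted_norm r m (0 : A) = 0.
Proof.
elim: m => //= m IH; rewrite [X in X + _]big1 => [|i _]; last exact: Normc.normc0.
by rewrite big1 ?mulr0 ?addr0 // => a _; rewrite raddf0.
Qed.

Lemma weighted_norm_sum r m (I : Type) (u : seq I) (P : pred I) (F : I -> A) : 0 <= r ->
  weighted_norm r m (\sum_(i <- u | P i) F i) <= \sum_(i <- u | P i) weighted_norm r m (F i).
Proof.
move=> r0; elim/big_rec2: _ => [|i x g _ IH]; first by rewrite weighted_norm0.
by apply: le_trans (weighted_normD _ _ _ r0) _; rewrite lerD2l.
Qed.

Lemma weighted_norm_order r m f : order_ge m f -> weighted_norm r m f = 0.
Proof.
elim: m f => //= m IH f fm.
rewrite [X in X + _]big1 => [|i _]; last first.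
  by rewrite order_ge1_vcoef ?Normc.normc0 //; exact: order_ge_le fm.
by rewrite big1 ?mulr0 ?addr0 // => a _; apply: IH; exact: order_ge_lderiv.
Qed.

(** Paths of length [m] or more are not counted, so in norm estimates a limit may be replaced by an
    approximant. *)
Lemma weighted_norm_congr r m f g : 0 <= r -> order_ge m (f - g) ->
  weighted_norm r m f <= weighted_norm r m g.
Proof.
move=> r0 /weighted_norm_order => /(_ r) fg.
by rewrite -[f](subrK g); apply: le_trans (weighted_normD _ _ _ r0) _; rewrite fg add0r.
Qed.

Lemma coef_weighted_norm r m f p : 0 <= r -> (plength p < m)%N ->
  normc (f p) * r ^+ plength p <= weighted_norm r m f.
Proof.
move=> r0; elim: m f p => // m IH f p.
have [[i ->] _|[a [q [e ->]]]] := qpath_case p.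
  rewrite /plength /= expr0 mulr1 (bigD1 i) //= -addrA lerDl.
  by rewrite addr_ge0 ?mulr_ge0 ?sumr_ge0 // => *; rewrite ?normc_ge0 ?weighted_norm_ge0.
rewrite plength_cons // => qm /=; rewrite (bigD1 a) //= mulrDr addrCA exprS mulrCA -lderivE //.
apply: le_trans (ler_wpM2l r0 (IH _ _ qm)) _; rewrite lerDl.
by rewrite addr_ge0 ?mulr_ge0 ?sumr_ge0 // => *; rewrite ?normc_ge0 ?weighted_norm_ge0.
Qed.

Lemma weighted_norm_vertex r m d :
  weighted_norm r m (vertex_series d : A) <= \sum_i normc (d i).
Proof.
case: m => [|m] /=; first by rewrite sumr_ge0 // => *; exact: normc_ge0.
rewrite [X in r * X]big1 ?mulr0 ?addr0 // => a _.
by rewrite lderiv_vertex weighted_norm0.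
Qed.

Lemma weighted_norm_const r m c f :
  weighted_norm r m (const_series c * f) = normc c * weighted_norm r m f.
Proof.
elim: m f => [|m IH] f /=; first by rewrite mulr0.
rewrite mulrDr mulrCA; congr (_ + _ * _); rewrite mulr_sumr.
  by apply: eq_bigr => i _; rewrite vcoefM Normc.normcM.
apply: eq_bigr => a _; rewrite lderivM lderiv_vertex mul0r add0r -IH.
by congr weighted_norm.
Qed.

Lemma normc_nat (b : bool) : normc (b%:R : R[i]) = b%:R :> R.
Proof. by case: b; rewrite ?Normc.normc1 ?Normc.normc0. Qed.

Lemma weighted_norm_idem r m i : weighted_norm r m (vertex_idem R i) <= 1.
Proof.
apply: le_trans (weighted_norm_vertex _ _ _) _.
rewrite (bigD1 i) //= eqxx normc_nat big1 ?addr0 // => j /negPf ->.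
by rewrite normc_nat.
Qed.

Lemma weighted_norm_mul_idem r m f i : 0 <= r ->
  weighted_norm r m (f * vertex_idem R i) <= weighted_norm r m f.
Proof.
move=> r0; apply: weighted_norm_le => // p.
rewrite mul_vertexE Normc.normcM normc_nat ler_piMr ?normc_ge0 //.
by case: (_ == _).
Qed.

Lemma normc_vcoef_le f i : normc (vcoef f i) <= \sum_j normc (vcoef f j).
Proof. by rewrite (bigD1 i) //= lerDl sumr_ge0 // => *; exact: normc_ge0. Qed.

(** Induction on the truncation through [lderivM]; the vertex terms and the derivative terms
    recombine into the expanded product of the two norms. *)
Lemma weighted_normM r m f g : 0 <= r ->
  weighted_norm r m (f * g) <= weighted_norm r m f * weighted_norm r m g.
Proof.
move=> r0; elim: m f g => [|m IH] f g; first by rewrite /= mulr0.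
(* The induction hypothesis for [lderiv a f * g] leaves [g] truncated at [m], while the goal has it
   truncated at [m.+1]. *)
have gm : weighted_norm r m g <= weighted_norm r m.+1 g by exact: weighted_norm_leS.
move: gm; rewrite /=; set G0 := \sum_i _; set G1 := \sum_a _; set F0 := \sum_i normc (vcoef f i).
set F1 := \sum_a weighted_norm r m (lderiv a f) => gm.
have F00 : 0 <= F0 by rewrite sumr_ge0 // => *; exact: normc_ge0.
have F10 : 0 <= F1 by rewrite sumr_ge0 // => *; exact: weighted_norm_ge0.
have h0 : \sum_i normc (vcoef (f * g) i) <= F0 * G0.
  rewrite mulr_sumr; apply: ler_sum => i _; rewrite vcoefM Normc.normcM.
  by rewrite ler_wpM2r ?normc_ge0 ?normc_vcoef_le.
have h1 : \sum_a weighted_norm r m (lderiv a (f * g)) <= F1 * (G0 + r * G1) + F0 * G1.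
  rewrite [F1 * _]mulr_suml [F0 * _]mulr_sumr -big_split /=; apply: ler_sum => a _; rewrite lderivM.
  apply: le_trans (weighted_normD _ _ _ r0) _; apply: lerD.
    by apply: le_trans (IH _ _) _; rewrite ler_wpM2l ?weighted_norm_ge0.
  by rewrite weighted_norm_const ler_wpM2r ?weighted_norm_ge0 ?normc_vcoef_le.
apply: le_trans (lerD h0 (ler_wpM2l r0 h1)) _.
by rewrite le_eqVlt; apply/orP; left; apply/eqP; ring.
Qed.

Lemma weighted_norm_arrow r m a : 0 <= r -> weighted_norm r m (arrow_series R a) <= r.
Proof.
case: m => [|m] //= r0; rewrite [X in X + _]big1 => [|i _]; last first.
  by rewrite vcoef_arrow Normc.normc0.
rewrite add0r (bigD1 a) //= big1 => [|b /negPf ba]; last by rewrite lderiv_arrow ba weighted_norm0.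
by rewrite addr0 lderiv_arrow eqxx ler_piMr ?weighted_norm_idem.
Qed.

(** Unlike [weighted_normM], this lowers the truncation along with the length, which
    [weighted_norm_rotate] needs to compare norms at one truncation. *)
Lemma weighted_norm_mul_arrow r m f a : 0 <= r ->
  weighted_norm r m.+1 (f * arrow_series R a) <= r * weighted_norm r m f.
Proof.
move=> r0; elim: m f => [|m IH] f.
  rewrite /= mulr0 [X in X + _]big1 => [|i _]; last first.
    by rewrite vcoefM vcoef_arrow mulr0 Normc.normc0.
  by rewrite big1 ?mulr0 ?addr0.
rewrite [leLHS]weighted_normS [X in X + _]big1 => [|i _]; last first.
  by rewrite vcoefM vcoef_arrow mulr0 Normc.normc0.
rewrite add0r ler_wpM2l //.
apply: (@le_trans _ _ (\sum_b (r * weighted_norm r m (lderiv b f) +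
   normc (vcoef f (tgt b)) * (b == a)%:R))).
  apply: ler_sum => b _; rewrite lderivM; apply: le_trans (weighted_normD _ _ _ r0) _.
  apply: lerD; first exact: IH.
  rewrite weighted_norm_const ler_wpM2l ?normc_ge0 // lderiv_arrow.
  by case: eqP => _; rewrite ?weighted_norm0 ?weighted_norm_idem.
rewrite big_split /= -mulr_sumr addrC lerD2r (bigD1 a) //= eqxx mulr1 big1 => [|b /negPf ->].
  by rewrite addr0 normc_vcoef_le.
by rewrite mulr0.
Qed.

(** By submultiplicativity, a word of length [l] becomes a series of norm at most [t ^+ l]. *)
Lemma weighted_norm_subst r t m h f : admissible h -> 0 <= r -> 0 <= t ->
  (forall a, weighted_norm r m (h a) <= t) ->
  weighted_norm r m (subst h f) <= weighted_norm t m f.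
Proof.
move=> ha r0 t0 ht; apply: le_trans (weighted_norm_congr r0 (subst_recP ha (n := m) (f := f))) _.
(* The fuel [k] is separated from the truncation [m], which stays fixed during the induction. *)
suff H k : weighted_norm r m (subst_rec h k f) <= weighted_norm t k f by exact: H.
elim: k f => [|k IH] f /=; first by rewrite weighted_norm0.
apply: le_trans (weighted_normD _ _ _ r0) _; apply: lerD; first exact: weighted_norm_vertex.
apply: le_trans (weighted_norm_sum _ _ _ _ r0) _; rewrite mulr_sumr; apply: ler_sum => a _.
by apply: le_trans (weighted_normM _ _ _ r0) _; apply: ler_pM; rewrite ?weighted_norm_ge0.
Qed.

(** Without constant term the norm shrinks at least linearly in the radius, every word carrying at
    least one factor of it. *)
Lemma weighted_norm_scale r s m f : 0 <= s -> s <= r -> order_ge 1 f ->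
  r * weighted_norm s m f <= s * weighted_norm r m f.
Proof.
move=> s0 sr f1; have r0 := le_trans s0 sr; case: m => [|m]; first by rewrite /= !mulr0.
have e : \sum_i normc (vcoef f i) = 0.
  by apply: big1 => i _; rewrite order_ge1_vcoef ?Normc.normc0.
rewrite /= e !add0r mulrCA !ler_wpM2l //; apply: ler_sum => a _.
elim: m {f1 e} (lderiv a f) => //= m IH g.
by rewrite lerD2l ler_pM // ?sumr_ge0 ?ler_sum // => *; exact: weighted_norm_ge0.
Qed.

(** * Rotation and collection in the weighted norm *)

Section Collect.
Variable S : pred (arrow Q).

(** Words starting in [S] are counted in the first summand and the others, rotated at constant
    length, in the second. *)
Lemma weighted_norm_rotate r m W : 0 <= r ->
  r * (\sum_(a | S a) weighted_norm r m (lderiv a W)) + weighted_norm r m.+1 (rotate S W)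
    <= weighted_norm r m.+1 W.
Proof.
move=> r0; rewrite [leRHS]weighted_normS.
have -> : \sum_a weighted_norm r m (lderiv a W) =
    \sum_(a | S a) weighted_norm r m (lderiv a W) +
    \sum_(a | ~~ S a) weighted_norm r m (lderiv a W) by rewrite (bigID S).
rewrite mulrDr [leRHS]addrCA lerD2l ler_wpDl //.
  by rewrite sumr_ge0 // => *; exact: normc_ge0.
apply: le_trans (weighted_norm_sum _ _ _ _ r0) _; rewrite mulr_sumr.
by apply: ler_sum => a _; exact: weighted_norm_mul_arrow.
Qed.

Lemma weighted_norm_iter_rotate r m n W : 0 <= r ->
  r * (\sum_(a | S a) \sum_(j < n) weighted_norm r m (lderiv a (iter j (rotate S) W)))
    + weighted_norm r m.+1 (iter n (rotate S) W) <= weighted_norm r m.+1 W.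
Proof.
move=> r0; elim: n => [|n IH].
  by rewrite big1 ?mulr0 ?add0r // => a _; rewrite big_ord0.
under eq_bigr => a _ do rewrite big_ord_recr /=.
rewrite big_split /= mulrDr -addrA; apply: le_trans IH; rewrite lerD2l.
exact: weighted_norm_rotate.
Qed.

Lemma weighted_norm_hit_part r m W : 0 <= r ->
  weighted_norm r m (hit_part S W) <= weighted_norm r m W.
Proof.
move=> r0; apply: weighted_norm_le => // p; rewrite /hit_part.
by case: ifP => // _; rewrite Normc.normc0 normc_ge0.
Qed.

(* Each coefficient of W is used at most once in the family of all [collect a W]. *)
Lemma weighted_norm_collect r m W : 0 <= r ->
  r * (\sum_(a | S a) weighted_norm r m (collect S a W)) <= weighted_norm r m.+1 W.
Proof.
move=> r0; apply: le_trans (weighted_norm_hit_part _ _ r0).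
apply: le_trans (weighted_norm_iter_rotate m m _ r0).
apply: ler_wpDr; first exact: weighted_norm_ge0.
rewrite ler_wpM2l //; apply: ler_sum => a _.
apply: le_trans (weighted_norm_congr r0 (collectP (S := S) (a := a) (W := W) (n := m))) _.
exact: weighted_norm_sum.
Qed.

End Collect.

(** The truncated norm at radius 1 bounds the finitely many coefficients not controlled by the
    eventual estimate; the maximum with 1 keeps the powers from shrinking. *)
Lemma analytic_bound f : analytic f -> exists B C, [/\ 0 <= B, 1 <= C &
  forall p, normc (f p) <= B * C ^+ plength p].
Proof.
move=> [C C0 [N hN]]; pose B := weighted_norm 1 N f.
have B0 : 0 <= B by exact: weighted_norm_ge0.
exists (1 + B), (Num.max 1 C); split; rewrite ?addr_ge0 // ?le_max ?lexx // => p.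
have C1 : 1 <= Num.max 1 C ^+ plength p by rewrite exprn_ege1 // le_max lexx.
have [pN|Np] := ltnP (plength p) N.
  have := coef_weighted_norm f ler01 pN; rewrite expr1n mulr1 -/B => h.
  by apply: le_trans h _; rewrite -[leLHS]mulr1; apply: ler_pM => //; lra.
have := hN p Np; rewrite normc_norm lecR => h; apply: le_trans h _.
rewrite -[leLHS]mul1r; apply: ler_pM => //; rewrite ?exprn_ge0 ?(ltW C0) //; first lra.
by rewrite lerXn2r ?nnegrE ?(ltW C0) ?le_max ?lexx ?orbT ?ler01.
Qed.

Lemma bound_analytic f r M : 0 < r ->
  (forall p, normc (f p) * r ^+ plength p <= M) -> analytic f.
Proof.
move=> r0 hM; have M1 : 1 <= Num.max 1 M by rewrite le_max lexx.
exists (Num.max 1 M / r); first by rewrite divr_gt0 // (lt_le_trans ltr01).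
(* From length 1 on, [Num.max 1 M] is at most its own power, so the constant is absorbed into the
   base. *)
exists 1%N => p p1; rewrite normc_norm lecR exprMn exprVn ler_pdivlMr ?exprn_gt0 //.
apply: le_trans (hM p) _; apply: (@le_trans _ _ (Num.max 1 M)); first by rewrite le_max lexx orbT.
by rewrite -[leLHS]expr1 ler_weXn2l.
Qed.

(** There are at most [#|vertex Q| * #|arrow Q| ^ l] paths of length [l], so the norm is dominated
    by a geometric series of ratio at most 1/2 starting at exponent [k]; this ratio gives the factor
    2. *)
Lemma weighted_norm_bound B C t m k f : 0 <= B -> 0 <= C -> 0 <= t ->
  #|arrow Q|%:R * C * t <= 2^-1 -> order_ge k f ->
  (forall p, normc (f p) <= B * C ^+ plength p) ->
  weighted_norm t m f <= (#|arrow Q|%:R * C * t) ^+ k * (2 * B * #|vertex Q|%:R).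
Proof.
move=> + C0 t0; set K := _ * _ * _ => + K2.
have K0 : 0 <= K by rewrite !mulr_ge0.
elim: m k B f => [|m IH] k B f B0 kf hf.
  by rewrite /= !mulr_ge0 ?exprn_ge0.
have hd a p : normc (lderiv a f p) <= B * C * C ^+ plength p.
  rewrite /lderiv; case: (eqVneq (path_tgt p) (src a)) => [e|_]; last first.
    by rewrite Normc.normc0 !mulr_ge0 ?exprn_ge0.
  by apply: le_trans (hf _) _; rewrite plength_cons // exprS mulrA.
(* The alternative serves both cases to come: [k = j.+1], and [k = 0], where the derivatives are
   also used at order 0. *)
have hS j : order_ge j.+1 f \/ j = 0%N -> t * \sum_a weighted_norm t m (lderiv a f) <=
    K ^+ j.+1 * (2 * B * #|vertex Q|%:R).
  move=> jf; have jd a : order_ge j (lderiv a f).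
    by case: jf => [/order_ge_lderiv //|->]; exact: order_ge0.
  apply: (@le_trans _ _ (t * \sum_(a : arrow Q) (K ^+ j * (2 * (B * C) * #|vertex Q|%:R)))).
    rewrite ler_wpM2l //; apply: ler_sum => a _; apply: IH => //.
    by rewrite mulr_ge0.
  rewrite sumr_const cardE -cardE -mulr_natl exprS le_eqVlt; apply/orP; left; apply/eqP.
  rewrite /K; ring.
case: k kf => [|k] kf.
  have := hS 0%N (or_intror erefl); rewrite expr1 expr0 mul1r /= => h.
  have h0 : \sum_i normc (vcoef f i) <= B * #|vertex Q|%:R.
    rewrite mulr_natr -sumr_const; apply: ler_sum => i _.
    by apply: le_trans (hf _) _; rewrite /plength /= mulr1.
  apply: le_trans (lerD h0 h) _.
  (* Half of the claimed bound is left for the tail, the other half being taken by the vertex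
     terms. *)
  have : K * (2 * B * #|vertex Q|%:R) <= 2^-1 * (2 * B * #|vertex Q|%:R).
    by rewrite ler_wpM2r // !mulr_ge0.
  lra.
rewrite /= [X in X + _]big1 => [|i _]; first by rewrite add0r; apply: hS; left.
by rewrite order_ge1_vcoef ?Normc.normc0 //; exact: order_ge_le kf.
Qed.

End WeightedNorm.

(** * The fixed-point equation *)

Section Splitting.
Variables (R : realType) (Q : quiver) (y z : arrow Q) (F : cpath_alg R Q).
Hypotheses (yz : y <> z) (st : src y = tgt z) (ts : src z = tgt y).
Hypothesis (Ford : order_ge 3 F).
Local Notation A := (cpath_alg R Q).
Local Notation ys := (arrow_series R y).
Local Notation zs := (arrow_series R z).
Local Notation idem i := (vertex_idem R i).
Local Notation wn := weighted_norm.
Implicit Types (f W : A) (X : A * A).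

Let S : pred (arrow Q) := fun a => (a == y) || (a == z).

Let zy : (z == y) = false. Proof. by apply/eqP => e; exact: yz. Qed.

(** The components of [X] are eta and zeta of the overview, in this order. *)
Definition shifted_arrow X (a : arrow Q) : A :=
  if a == y then ys + X.1 else if a == z then zs + X.2 else arrow_series R a.

Definition split_remainder X : A := subst (shifted_arrow X) F - X.1 * X.2.

(** Words brought to start with [z] determine eta, because a product of [z] with a series is
    cyclically that series times [z]; those starting with [y] determine zeta. The idempotents make
    eta and zeta start where [y] and [z] do. *)
Definition split_step X : A * A :=
  (collect S z (split_remainder X) * idem (src y),
   collect S y (split_remainder X) * idem (src z)).

Definition admissible_pair X :=
  [/\ order_ge 2 X.1, order_ge 2 X.2, idem (tgt y) * X.1 = X.1 & idem (tgt z) * X.2 = X.2].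

Lemma shift_admissible X : admissible_pair X -> admissible (shifted_arrow X).
Proof.
move=> [o1 o2 t1 t2] a; rewrite /shifted_arrow.
have [ha ea] := arrow_admissible R a.
case: (eqVneq a y) => [ay|_].
  split; first by apply: order_geD; [exact: order_ge_arrow | exact: order_ge_le o1].
  by rewrite -ay in t1 *; rewrite mulrDr ea t1.
case: (eqVneq a z) => [az|_] //.
split; first by apply: order_geD; [exact: order_ge_arrow | exact: order_ge_le o2].
by rewrite -az in t2 *; rewrite mulrDr ea t2.
Qed.

Lemma order_remainder X : admissible_pair X -> order_ge 3 (split_remainder X).
Proof.
move=> gX; have [o1 o2 _ _] := gX; apply: order_geB.
  by apply: order_ge_subst => //; exact: shift_admissible.
by apply: (@order_ge_le _ _ _ (2 + 2)) => //; exact: order_geM.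
Qed.

Lemma order_mul_idem n f i : order_ge n f -> order_ge n (f * idem i).
Proof. by move=> fn; rewrite -[n]addn0; apply: order_geM. Qed.

Lemma step_good X : admissible_pair X -> admissible_pair (split_step X).
Proof.
move=> gX; have W3 := order_remainder gX.
split; rewrite /split_step /=.
- by apply: order_mul_idem; exact: order_ge_collect.
- by apply: order_mul_idem; exact: order_ge_collect.
- by rewrite mulrA -ts idem_collect.
- by rewrite mulrA -st idem_collect.
Qed.

Definition congruent_pairs n X X' := order_ge n (X.1 - X'.1) /\ order_ge n (X.2 - X'.2).

(** The remainders agree to order [n.+2]: [subst_lipschitz] gains 2 since [F] has order 3, and the
    product gains 2 since its factors have order 2. Collecting loses one order. *)
Lemma step_contract n X X' :
  admissible_pair X -> admissible_pair X' -> (0 < n)%N -> congruent_pairs n X X' ->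
  congruent_pairs n.+1 (split_step X) (split_step X').
Proof.
move=> gX gX' n0 [c1 c2].
have [o1 o2 _ _] := gX; have [o1' o2' _ _] := gX'.
have W : order_ge n.+2 (split_remainder X - split_remainder X').
  rewrite /split_remainder opprB [X'.1 * _ - _]addrC addrACA; apply: order_geD.
    apply: (@order_ge_le _ _ _ (n + 2)); first by rewrite addn2.
    apply: (subst_lipschitz (k := 3)) => //; [exact: shift_admissible..|].
    move=> a; rewrite /shifted_arrow; case: ifP => _; first by rewrite opprD addrACA subrr add0r.
    case: ifP => _; first by rewrite opprD addrACA subrr add0r.
    by rewrite subrr; exact: order_ge_zero.
  rewrite [- _ + _]addrC; apply: order_ge_subC.
  rewrite -(subrKA (X'.1 * X.2)) -mulrBl -mulrBr; apply: order_geD.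
    by rewrite -addn2; apply: order_geM.
  by rewrite -add2n; apply: order_geM.
by split; rewrite /split_step /= -mulrBl -raddfB /=; apply: order_mul_idem;
  exact: order_ge_collect.
Qed.

Definition split_iterate n : A * A := iter n split_step (0, 0).

Lemma iterate_good n : admissible_pair (split_iterate n).
Proof.
elim: n => [|n IH]; last exact: step_good.
by split; rewrite /= ?mulr0 //; exact: order_ge_zero.
Qed.

Lemma iterate_close n : congruent_pairs n.+1 (split_iterate n.+1) (split_iterate n).
Proof.
elim: n => [|n IH].
  have [o1 o2 _ _] := iterate_good 1.
  split; rewrite -[X in _ - X]/(0 : A) subr0.
    exact: (order_ge_le (isT : 1 <= 2)%N o1).
  exact: (order_ge_le (isT : 1 <= 2)%N o2).
exact: (step_contract (iterate_good n.+1) (iterate_good n) (ltn0Sn n) IH).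
Qed.

Definition split_solution : A * A :=
  (adic_lim (fun n => (split_iterate n).1), adic_lim (fun n => (split_iterate n).2)).

Lemma solution_close n : congruent_pairs n split_solution (split_iterate n).
Proof.
by split; apply: (adic_limP (s := fun n => _)) => m;
  have [h1 h2] := iterate_close m; exact: order_ge_le (leqnSn m) _.
Qed.

Lemma solution_good : admissible_pair split_solution.
Proof.
have [c1 c2] := solution_close 2; have [o1 o2 _ _] := iterate_good 2.
split.
- by rewrite -[split_solution.1](subrK (split_iterate 2).1); exact: order_geD.
- by rewrite -[split_solution.2](subrK (split_iterate 2).2); exact: order_geD.
- apply/funext => p; have [_ _ e _] := iterate_good (plength p).+1.
  by rewrite vertex_mulE /= /adic_lim -[in RHS]e vertex_mulE.
- apply/funext => p; have [_ _ _ e] := iterate_good (plength p).+1.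
  by rewrite vertex_mulE /= /adic_lim -[in RHS]e vertex_mulE.
Qed.

(** Both sides agree with the iterate [n.+2] to order [n.+2], for every [n]. *)
Lemma solution_fixed : split_step split_solution = split_solution.
Proof.
have c n : congruent_pairs n.+2 (split_step split_solution) split_solution.
  have [a1 a2] := step_contract solution_good (iterate_good n.+1) (ltn0Sn n) (solution_close n.+1).
  have [b1 b2] := solution_close n.+2.
  by split; [apply: (order_ge_trans a1) | apply: (order_ge_trans a2)]; exact: order_ge_subC.
have e1 : (split_step split_solution).1 = split_solution.1.
  by apply: order_ge_eq => n; have [h _] := c n; exact: (order_ge_le (leqW (leqnSn n)) h).
have e2 : (split_step split_solution).2 = split_solution.2.
  by apply: order_ge_eq => n; have [_ h] := c n; exact: (order_ge_le (leqW (leqnSn n)) h).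
by move: e1 e2; case: (split_step split_solution) => ? ?; case: split_solution => ? ? /= -> ->.
Qed.

Lemma order_shift X a : admissible_pair X -> order_ge 2 (shifted_arrow X a - arrow_series R a).
Proof.
move=> [o1 o2 _ _]; rewrite /shifted_arrow.
case: (eqVneq a y) => [->|_]; first by rewrite addrAC subrr add0r.
case: (eqVneq a z) => [->|_]; first by rewrite addrAC subrr add0r.
by rewrite subrr; exact: order_ge_zero.
Qed.

(** * Norm bounds on the fixed point and analyticity *)

Section Bounds.
Variable r : R.
Hypotheses (r0 : 0 < r) (hF : forall m, wn (2 * r) m F <= r ^+ 2 / 8).

Let r0' : 0 <= r := ltW r0.

Definition small_pair (s : R) X := forall m, wn s m X.1 + wn s m X.2 <= s / 4.

Lemma shift_bound (s : R) X m a : 0 <= s -> small_pair s X -> wn s m (shifted_arrow X a) <= 2 * s.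
Proof.
move=> s0 sX; have h := sX m.
have p1 := weighted_norm_ge0 m X.1 s0; have p2 := weighted_norm_ge0 m X.2 s0.
have ar (b : arrow Q) : wn s m (arrow_series R b) <= s by exact: weighted_norm_arrow.
rewrite /shifted_arrow; case: ifP => _.
  apply: le_trans (weighted_normD _ _ _ s0) _; have := ar y; lra.
case: ifP => _; last by have := ar a; lra.
apply: le_trans (weighted_normD _ _ _ s0) _; have := ar z; lra.
Qed.

(** The shifted arrows have norm at most [2 * r], so [hF] bounds the substituted series by
    [r ^+ 2 / 8]; the product adds at most [(r / 4) ^+ 2]. *)
Lemma remainder_bound X m : admissible_pair X -> small_pair r X ->
  wn r m (split_remainder X) <= r ^+ 2 / 4.
Proof.
move=> gX sX; apply: le_trans (weighted_normD _ _ _ r0') _; rewrite weighted_normN.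
have h1 : wn r m (subst (shifted_arrow X) F) <= r ^+ 2 / 8.
  apply: le_trans (hF m); apply: weighted_norm_subst => //.
  - exact: shift_admissible.
  - by rewrite mulr_ge0.
  - by move=> a; exact: shift_bound.
have h2 := weighted_normM m X.1 X.2 r0'; have h := sX m.
have p1 := weighted_norm_ge0 m X.1 r0'; have p2 := weighted_norm_ge0 m X.2 r0'.
have : wn r m X.1 * wn r m X.2 <= r / 4 * (r / 4) by apply: ler_pM => //; lra.
move: h1 h2; rewrite expr2; set u := wn _ _ (subst _ _); set v := wn _ _ (_ * _).
set w := _ * _ * _^-1; move=> a b c; have := sqr_ge0 r; rewrite expr2 => d.
rewrite /w in a *; lra.
Qed.

(** Collecting removes one letter, which divides the bound [r ^+ 2 / 4] by [r]. *)
Lemma step_small X : admissible_pair X -> small_pair r X -> small_pair r (split_step X).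
Proof.
move=> gX sX m; have h1 := remainder_bound m.+1 gX sX.
have h2 := weighted_norm_collect S m (split_remainder X) r0'.
have : r * (wn r m (collect S z (split_remainder X)) +
            wn r m (collect S y (split_remainder X))) <= r ^+ 2 / 4.
  apply: le_trans (le_trans h2 h1).
  rewrite ler_wpM2l // (bigD1 z) /=; last by rewrite /S eqxx orbT.
  rewrite lerD2l (bigD1 y) /=; last by rewrite /S eqxx /= eq_sym zy.
  by rewrite lerDl sumr_ge0 // => *; exact: weighted_norm_ge0.
rewrite expr2 -mulrA ler_pM2l //; apply: le_trans.
by apply: lerD; exact: weighted_norm_mul_idem.
Qed.

Lemma solution_small : small_pair r split_solution.
Proof.
have sm n : small_pair r (split_iterate n).
  elim: n => [|n IH]; last by apply: step_small => //; exact: iterate_good.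
  by move=> m; rewrite /= !weighted_norm0 addr0 divr_ge0.
move=> m; apply: le_trans (sm m m); have [c1 c2] := solution_close m.
by apply: lerD; apply: weighted_norm_congr.
Qed.

(** An arbitrary analytic series may force a radius smaller than [r]; linear shrinking of the norm
    carries the bound there. *)
Lemma solution_small_le (s : R) : 0 <= s -> s <= r -> small_pair s split_solution.
Proof.
move=> s0 sr m; have [o1 o2 _ _] := solution_good.
have h1 := weighted_norm_scale m s0 sr (order_ge_le (isT : 1 <= 2)%N o1).
have h2 := weighted_norm_scale m s0 sr (order_ge_le (isT : 1 <= 2)%N o2).
rewrite -(ler_pM2l r0) mulrDr; apply: le_trans (lerD h1 h2) _.
rewrite -mulrDr mulrCA ler_wpM2l // mulrC; apply: le_trans (solution_small m) _.
by rewrite mulrC.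
Qed.

Lemma subst_solution_analytic f :
  analytic f -> analytic (subst (shifted_arrow split_solution) f).
Proof.
move=> /analytic_bound[B [C [B0 C1 hf]]].
have C0 : 0 <= C by exact: le_trans C1.
pose K : R := #|arrow Q|%:R * C; have K0 : 0 <= K by rewrite mulr_ge0.
(* Chosen so that [K * (2 * s)] is at most 1/2, as [weighted_norm_bound] requires at radius [2 * s];
   the summand 1 keeps the denominator positive. *)
pose s := Num.min r (4 * K + 1)^-1.
have Kp : 0 < 4 * K + 1 by rewrite ltr_wpDl ?mulr_ge0.
have s0 : 0 < s by rewrite lt_min r0 invr_gt0 Kp.
have sr : s <= r by rewrite ge_min lexx.
have sK : K * (2 * s) <= 2^-1.
  have : s <= (4 * K + 1)^-1 by rewrite ge_min lexx orbT.
  rewrite -(ler_pM2l Kp) mulfV ?gt_eqF // => h; lra.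
apply: (bound_analytic s0 (M := 2 * B * #|vertex Q|%:R)) => p.
apply: le_trans (coef_weighted_norm _ (ltW s0) (ltnSn _)) _.
have s2 : 0 <= 2 * s by rewrite mulr_ge0 // ltW.
apply: le_trans (weighted_norm_subst _ _ (ltW s0) s2 _) _.
- exact: shift_admissible solution_good.
- by move=> a; apply: shift_bound (ltW s0) _; exact: solution_small_le (ltW s0) sr.
- have := weighted_norm_bound (plength p).+1 B0 C0 s2 sK (order_ge0 (f := f)) hf.
  by rewrite expr0 mul1r.
Qed.

Lemma remainder_part_analytic :
  analytic (split_remainder split_solution - hit_part S (split_remainder split_solution)).
Proof.
apply: (bound_analytic r0 (M := r ^+ 2 / 4)) => p.
apply: le_trans (remainder_bound (plength p).+1 solution_good solution_small).
apply: le_trans (coef_weighted_norm _ r0' (ltnSn _)).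
rewrite ler_wpM2r ?exprn_ge0 // series_subE /hit_part.
by case: ifP; rewrite ?subr0 ?subrr ?Normc.normc0 ?normc_ge0.
Qed.

End Bounds.

Lemma avoiding_part W : series_avoiding y z (W - hit_part S W).
Proof.
move=> p; rewrite series_subE /hit_part; case: ifPn; first by rewrite subrr eqxx.
rewrite -all_predC => /allP hS _; apply/andP.
by split; apply/negP => /hS; rewrite /S /= eqxx ?orbT.
Qed.

(** As [F] has order 3, its norm at radius [2 * r] is of size [r ^+ 3], hence below [r ^+ 2 / 8] for
    small [r]. *)
Lemma radius_exists : analytic F ->
  exists2 r : R, 0 < r & forall m, wn (2 * r) m F <= r ^+ 2 / 8.
Proof.
move=> /analytic_bound[B [C [B0 C1 hF]]].
have C0 : 0 <= C by exact: le_trans C1.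
pose K : R := #|arrow Q|%:R * C; have K0 : 0 <= K by rewrite mulr_ge0.
pose D : R := 2 * B * #|vertex Q|%:R; have D0 : 0 <= D by rewrite !mulr_ge0.
(* With [r] the inverse of [E], the first summand gives [K * (2 * r) <= 1/2], the second
   [8 * (D * K ^+ 3 * r) <= 1/8], and the third makes [E] positive. *)
pose E := 4 * K + 64 * D * K ^+ 3 + 1.
have DK : 0 <= D * K ^+ 3 by rewrite mulr_ge0 ?exprn_ge0.
have E0 : 0 < E by rewrite /E; lra.
pose r := E^-1; have r0 : 0 < r by rewrite invr_gt0.
have Er : E * r = 1 by rewrite mulfV ?gt_eqF.
have Kr : 0 <= K * r by rewrite mulr_ge0 // ltW.
have DKr : 0 <= D * K ^+ 3 * r by rewrite mulr_ge0 // ltW.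
exists r => // m.
have r2 : 0 <= 2 * r by rewrite mulr_ge0 // ltW.
have K2 : K * (2 * r) <= 2^-1 by move: Er; rewrite /E; lra.
apply: le_trans (weighted_norm_bound m B0 C0 r2 K2 Ford hF) _.
rewrite -/K -/D.
have -> : (K * (2 * r)) ^+ 3 * D = 8 * (D * K ^+ 3 * r) * r ^+ 2 by ring.
rewrite [leRHS]mulrC ler_wpM2r ?sqr_ge0 //.
by move: Er; rewrite /E; lra.
Qed.

(** The cross terms [ys * zeta] and [eta * zs] cancel, modulo commutators, the part of the remainder
    made of words meeting [y] or [z]. *)
Lemma subst_solution_potential :
  potential_of (subst (shifted_arrow split_solution) (ys * zs - F)) =
  potential_of (ys * zs -
    (split_remainder split_solution - hit_part S (split_remainder split_solution))).
Proof.
apply/potential_ofP.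
have ad := shift_admissible solution_good.
have [_ _ t1 t2] := solution_good.
set W := split_remainder split_solution.
set eta := split_solution.1; set zeta := split_solution.2.
have eE : eta = collect S z W * idem (src y) by rewrite /eta -{1}solution_fixed.
have zE : zeta = collect S y W * idem (src z) by rewrite /zeta -{1}solution_fixed.
have idemM (i : vertex Q) : idem i * idem i = idem i.
  rewrite /vertex_idem vertex_seriesM; congr vertex_series; apply/funext => j.
  by case: (j == i); rewrite ?mulr1 ?mulr0.
have arrow_idem (a : arrow Q) : arrow_series R a * idem (src a) = arrow_series R a.
  by have := subst_arrow (@arrow_admissible R Q) a; rewrite subst_id.
have Hy : subst (shifted_arrow split_solution) ys = ys + eta.
  by rewrite subst_arrow // /shifted_arrow eqxx mulrDl arrow_idem -/eta eE -mulrA idemM.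
have Hz : subst (shifted_arrow split_solution) zs = zs + zeta.
  by rewrite subst_arrow // /shifted_arrow zy eqxx mulrDl arrow_idem -/zeta zE -mulrA idemM.
have HF : subst (shifted_arrow split_solution) F = W + eta * zeta.
  by rewrite /W /split_remainder subrK.
have W1 : order_ge 1 W by apply: order_ge_le (order_remainder solution_good).
have := collect_comm S W1; rewrite (bigD1 y) /=; last by rewrite /S eqxx.
rewrite (big_pred1 z) => [hW|a]; last first.
  rewrite /S /=; case: (eqVneq a y) => [->|_]; first by rewrite eq_sym zy.
  by rewrite andbT.
set V := W - hit_part S W in hW *.
have [_ lz] := arrow_admissible R z; have [_ ly] := arrow_admissible R y.
have etaz : eta * zs = collect S z W * zs by rewrite eE -mulrA st lz.
have cz := commutator_space_closure (commutator_space_comm zs (collect S z W)).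
(* The part of [ys * collect S y W] cut off by the idempotent consists of paths that are not cyclic.
   It is the commutator of [idem (src z)] with itself, because [src z = tgt y]. *)
pose g := ys * collect S y W * (1 - idem (src z)).
have cy := commutator_space_closure (commutator_space_comm (idem (src z)) g).
have gE : idem (src z) * g - g * idem (src z) = ys * collect S y W - ys * zeta.
  rewrite /g -[_ * (1 - _) * _]mulrA mulrBl mul1r idemM subrr mulr0 subr0.
  by rewrite !mulrA ts ly mulrBr mulr1 zE ts mulrA.
rewrite gE in cy.
(* The three terms lie in the closure by [collect_comm], by the cut at [src z], and by the rotation
   of [z], respectively. *)
have -> : subst (shifted_arrow split_solution) (ys * zs - F) - (ys * zs - V) =
  - (W - (ys * collect S y W + zs * collect S z W + V))
  - (ys * collect S y W - ys * zeta) - (zs * collect S z W - collect S z W * zs).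
  rewrite substB substM // Hy Hz HF mulrDl !mulrDr -etaz.
  apply/funext => p; rewrite !(series_subE, series_addE, series_oppE); ring.
by apply: rpredB cz; apply: rpredB cy; rewrite rpredN.
Qed.

End Splitting.

Theorem proposition6p3 (R : realType) (Q : quiver) (y z : arrow Q)
    (F : cpath_alg R Q) (yz : y <> z) (st : src y = tgt z) (ts : src z = tgt y)
    (Fan : analytic F) (Ford : order_ge 3 F) :
  exists H : {rmorphism cpath_alg R Q -> cpath_alg R Q},
    analytic_automorphism H /\
    exists v : cpath_alg R Q,
      [/\ series_avoiding y z v, analytic v, order_ge 3 v &
          potential_of (H (arrow_series R y * arrow_series R z - F)) =
          potential_of (arrow_series R y * arrow_series R z - v)].
Proof.
have [r r0 hr] := radius_exists Ford Fan.
have good_sol := solution_good st ts Ford.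
have ad := shift_admissible good_sol.
have [H HE] := subst_rmorphism ad.
have HE' : H =1 subst (shifted_arrow y z (split_solution y z F)) by [].
exists H; split.
  split; last by move=> f fan; rewrite HE; exact: (subst_solution_analytic yz st ts Ford r0 hr).
  split; last by move=> d; rewrite HE; exact: subst_vertex.
  apply: eq_bij (fsym HE'); apply: subst_bijective => // a; exact: order_shift.
(* Unification with the equality of potentials supplies [v]: the part of the remainder free of [y]
   and [z]. *)
eexists; split; last by rewrite HE; exact: subst_solution_potential.
- exact: avoiding_part.
- exact: (remainder_part_analytic yz st ts Ford r0 hr).
- have W3 := order_remainder Ford good_sol.
  by apply: order_geB => //; exact: order_ge_hit_part.
Qed.
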